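(* Let $(a,b,c)$ be integers with $0<a+1<b<c$ and $(a+1)^2+\cdots+b^2=(b+1)^2+\cdots+c^2$. Then there exists an arithmetic polygon with side lengths $a+1,a+2,\dots,c$ which is not self-intersecting.
   Context: An arithmetic polygon is a (closed) polygon in the plane with integer side lengths and a distinguished vertex $O$ satisfying: (1) as one traverses the polygon starting and finishing at $O$, each side has length exactly one greater than the length of the side preceding it; (2) for each side of the polygon, there is a line perpendicular to that side which passes through both $O$ and one of the two endpoints of that side; (3) no vertex is degenerate, i.e., no vertex has an angle of $0$ or $\pi$ radians. A polygon is not self-intersecting if its sides meet only at shared endpoints of consecutive sides, so that it partitions the plane into a single interior and a single exterior. *)

(* Defs.v *)
From HB Require Import structures.
From mathcomp Require Import all_boot all_order all_algebra.
From mathcomp Require Import all_classical all_reals all_analysis.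

Set Implicit Arguments.
Unset Strict Implicit.
Unset Printing Implicit Defensive.

Import Order.TTheory GRing.Theory Num.Theory.

Local Open Scope ring_scope.

(* The increasing list of all integers k with m <= k <= n; empty if n < m. *)
Definition int_range (m n : int) : seq int :=
  if n - m + 1 is Posz l then [seq m + k%:Z | k <- iota 0 l] else [::].

(* The normed structure that the library puts on 'rV[R]_2 is the sup norm, so
   Euclidean lengths and angles are defined here from the dot product. *)
Definition dot (R : realType) (u w : 'rV[R]_2) : R :=
  \sum_(k < 2) u 0 k * w 0 k.

Definition enorm (R : realType) (u : 'rV[R]_2) : R := Num.sqrt (dot u u).

(* Unoriented angle, in [0, pi], between two nonzero vectors. *)
Definition angle (R : realType) (u w : 'rV[R]_2) : R :=
  acos (dot u w / (enorm u * enorm w)).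

Definition line (R : realType) (p d : 'rV[R]_2) : set 'rV[R]_2 :=
  [set x | exists t : R, x = p + t *: d].

Definition segment (R : realType) (p q : 'rV[R]_2) : set 'rV[R]_2 :=
  [set x | exists t : R, 0 <= t <= 1 /\ x = (1 - t) *: p + t *: q].

(* A closed polygon with n.+1 sides is the cyclic sequence v of its vertices,
   in the order of a traversal that starts at the distinguished vertex
   O = v ord0; ordS and ord_pred are the cyclic successor and predecessor.
   Side i goes from v i to v (ordS i), so side ord_max finishes at O. *)
Definition side_vec (R : realType) (n : nat) (v : 'I_n.+1 -> 'rV[R]_2)
  (i : 'I_n.+1) : 'rV[R]_2 := v (ordS i) - v i.

Definition side_length (R : realType) (n : nat) (v : 'I_n.+1 -> 'rV[R]_2)
  (i : 'I_n.+1) : R := enorm (side_vec v i).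

Definition side (R : realType) (n : nat) (v : 'I_n.+1 -> 'rV[R]_2)
  (i : 'I_n.+1) : set 'rV[R]_2 := segment (v i) (v (ordS i)).

Definition vertex_angle (R : realType) (n : nat) (v : 'I_n.+1 -> 'rV[R]_2)
  (i : 'I_n.+1) : R := angle (v (ord_pred i) - v i) (v (ordS i) - v i).

Record arithmetic_polygon (R : realType) (n : nat) (v : 'I_n.+1 -> 'rV[R]_2) :
    Prop := ArithmeticPolygon {
  ap_sides_ge3 : (3 <= n.+1)%N ;
  ap_length_gt0 : forall i, 0 < side_length v i ;
  ap_length_int : forall i, side_length v i \is a Num.int ;
  ap_length_succ : forall i, i != ord_max ->
    side_length v (ordS i) = side_length v i + 1 ;
  ap_perp : forall i, exists p d : 'rV[R]_2,
    [/\ d != 0, dot d (side_vec v i) = 0, line p d (v ord0) &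
        line p d (v i) \/ line p d (v (ordS i))] ;
  ap_nondegenerate : forall i, vertex_angle v i <> 0 /\ vertex_angle v i <> pi
}.

(* Distinct sides i and j can share a point only if one follows the other
   cyclically, and the point is then the vertex between them. *)
Definition not_self_intersecting (R : realType) (n : nat)
    (v : 'I_n.+1 -> 'rV[R]_2) : Prop :=
  forall (i j : 'I_n.+1) (x : 'rV[R]_2), i != j -> side v i x -> side v j x ->
    (j = ordS i /\ x = v j) \/ (i = ordS j /\ x = v i).

(* The side lengths in the order of the traversal. *)
Definition side_lengths (R : realType) (n : nat) (v : 'I_n.+1 -> 'rV[R]_2) :
  seq R := [seq side_length v i | i <- enum 'I_n.+1].

(* Main.v *)
(** Let [r k] be the distance from [O] to the vertex reached by the side of
length [k]. The right angles force [r k ^ 2 = r (k - 1) ^ 2 +- k ^ 2]; take the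
sign [+] up to [b] and [-] afterwards, so that the hypothesis closes the polygon.
On each of the two arcs the distance to [O] is strictly monotone, so neither arc
meets itself, whatever side each right triangle is built on. Construct both arcs
backwards from their common far vertex, placed on the positive x-axis: at each
step one of the two choices stays in a prescribed open half-plane, so the
outgoing arc can be kept above the axis and the incoming arc below it.

The only possible defect is that the first and last sides are opposite at [O].
Then reflect the first vertex in the line joining [O] to the second. Within the
disc of radius [r (a + 2)] the incoming arc consists of the last side and a part
of the one before it, and another line through [O] separates these from the
first two sides. *)
Require Import Defs.
From HB Require Import structures.
From mathcomp Require Import all_boot all_order all_algebra.
From mathcomp Require Import all_classical all_reals all_analysis.
From mathcomp Require Import ring lra zify.

Set Implicit Arguments.
Unset Strict Implicit.
Unset Printing Implicit Defensive.

Import Order.TTheory GRing.Theory Num.Theory.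

Local Open Scope ring_scope.

(** * Dot and cross products in the plane *)

Section Plane.
Variable R : realType.
Implicit Types (u w x s : 'rV[R]_2) (l : nat -> R).

Definition cross u w : R := u 0 0 * w 0 1 - u 0 1 * w 0 0.

Lemma dotE u w : dot u w = u 0 0 * w 0 0 + u 0 1 * w 0 1.
Proof.
rewrite /dot !big_ord_recl big_ord0 addr0.
by rewrite (_ : lift ord0 ord0 = 1) //; apply: val_inj.
Qed.

Lemma row2P u w : u 0 0 = w 0 0 -> u 0 1 = w 0 1 -> u = w.
Proof.
move=> h0 h1; apply/rowP => -[[|[|//]] hi].
  by rewrite (_ : Ordinal hi = 0) //; apply: val_inj.
by rewrite (_ : Ordinal hi = 1) //; apply: val_inj.
Qed.

Lemma dotDr u w x : dot u (w + x) = dot u w + dot u x.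
Proof. by rewrite !dotE !mxE; ring. Qed.

Lemma dotZr (k : R) u w : dot u (k *: w) = k * dot u w.
Proof. by rewrite !dotE !mxE; ring. Qed.

Lemma dotBr u w x : dot u (w - x) = dot u w - dot u x.
Proof. by rewrite !dotE !mxE; ring. Qed.

Lemma dotC u w : dot u w = dot w u.
Proof. by rewrite !dotE; ring. Qed.

Lemma dot_ge0 u : 0 <= dot u u.
Proof. by rewrite dotE; nra. Qed.

Lemma dot_eq0 u : (dot u u == 0) = (u == 0).
Proof.
apply/eqP/eqP => [|->]; last by rewrite dotE !mxE; ring.
rewrite dotE => h; apply: row2P; rewrite mxE; nra.
Qed.

Lemma lagrange u w : dot u w ^+ 2 + cross u w ^+ 2 = dot u u * dot w w.
Proof. by rewrite !dotE /cross; ring. Qed.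

(** Lagrange's identity makes the cosine strictly less than 1 in absolute value, while 0 and [pi]
    have cosines 1 and -1. *)
Lemma angle_nondegenerate u w :
  cross u w != 0 -> angle u w <> 0 /\ angle u w <> pi.
Proof.
move=> h; have h2 : 0 < cross u w ^+ 2 by rewrite exprn_even_gt0.
have := lagrange u w; have := dot_ge0 u; have := dot_ge0 w => w0 u0 hl.
have uw : 0 < dot u u * dot w w by have := sqr_ge0 (dot u w); lra.
rewrite /angle; set z := dot u w / _.
have z2 : z ^+ 2 < 1.
  rewrite /z expr_div_n exprMn !sqr_sqrtr // ltr_pdivrMr //; lra.
have zI : z \in `[-1, 1] by rewrite in_itv /=; nra.
have acz := acosK zI.
by split=> e; move: acz; rewrite e ?cos0 ?cospi => ez; move: z2; rewrite -ez; lra.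
Qed.

Lemma segmentC u w : segment u w = segment w u.
Proof.
by apply/seteqP; split=> x [t [ht ->]]; exists (1 - t);
  (split; [lra | rewrite opprB addrCA subrr addr0 addrC]).
Qed.

Lemma perp_line u s : s != 0 -> dot u s = 0 ->
  exists p d, [/\ d != 0, dot d s = 0, line p d (0 : 'rV[R]_2) & line p d u].
Proof.
move=> s0 us; have [->|u0] := eqVneq u 0; last first.
  exists 0, u; split=> //; first by exists 0; rewrite scale0r addr0.
  by exists 1; rewrite scale1r add0r.
(* At the origin [u] gives no direction, so [s] is rotated by a quarter turn. *)
pose d : 'rV[R]_2 := \row_k (if k == 0 then - s 0 1 else s 0 0).
have dd : dot d d = dot s s by rewrite !dotE !mxE /=; ring.
exists 0, d; split; try by exists 0; rewrite scale0r addr0.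
  by rewrite -dot_eq0 dd dot_eq0.
by rewrite dotE !mxE /=; ring.
Qed.

(* A path from the origin whose side [i] has length [l i] and meets at a right
   angle the line joining the origin to the starting point of that side. *)
Definition chain l m (u : nat -> 'rV[R]_2) : Prop :=
  u 0%N = 0 /\ forall i, (i < m)%N ->
    dot (u i) (u i.+1 - u i) = 0 /\
    dot (u i.+1 - u i) (u i.+1 - u i) = l i ^+ 2.

(** * Distances and intersections along a chain of right triangles *)

Section Chain.
Variables (l : nat -> R) (m : nat) (u : nat -> 'rV[R]_2).
Hypotheses (l_gt0 : forall i, (i < m)%N -> 0 < l i) (cu : chain l m u).

Lemma chain_dotS i : (i < m)%N ->
  dot (u i.+1) (u i.+1) = dot (u i) (u i) + l i ^+ 2.
Proof. by case: cu => _ h /h [h1 <-]; move: h1; rewrite !dotE !mxE; lra. Qed.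

Lemma chain_dot_lt i j : (i < j)%N -> (j <= m)%N ->
  dot (u i) (u i) < dot (u j) (u j).
Proof.
elim: j => // j IH; rewrite ltnS leq_eqVlt => /orP[/eqP -> | ij] jm.
  by rewrite chain_dotS // ltrDl exprn_gt0 ?l_gt0.
apply: lt_trans (IH ij (ltnW jm)) _.
by rewrite chain_dotS // ltrDl exprn_gt0 ?l_gt0.
Qed.

Lemma chain_dot_le i j : (i <= j)%N -> (j <= m)%N ->
  dot (u i) (u i) <= dot (u j) (u j).
Proof.
by rewrite leq_eqVlt => /orP[/eqP -> // | ij jm]; apply/ltW/chain_dot_lt.
Qed.

(** The squared distance to the origin at parameter [t] is [dot (u i) (u i) + t ^+ 2 * l i ^+ 2],
    strictly increasing on [0, 1]. *)
Lemma chain_seg i x : (i < m)%N -> segment (u i) (u i.+1) x ->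
  [/\ dot (u i) (u i) <= dot x x, dot x x <= dot (u i.+1) (u i.+1) &
      dot (u i.+1) (u i.+1) <= dot x x -> x = u i.+1].
Proof.
move=> im [t [ht ->]]; set y := _ + _; case: cu => _ /(_ _ im) [h1 h2].
have hy : dot y y = dot (u i) (u i) + t ^+ 2 * l i ^+ 2.
  rewrite -h2 -[LHS]subr0 -[X in _ - X](mulr0 (2 * t)) -h1.
  by rewrite /y !dotE !mxE; ring.
rewrite hy (chain_dotS im).
have l0 : 0 < l i ^+ 2 by rewrite exprn_gt0 ?l_gt0.
have t1 : t ^+ 2 <= 1 by nra.
split; [by have := sqr_ge0 t; nra | by nra |].
rewrite lerD2l -{1}[l i ^+ 2]mul1r ler_pM2r // => t2.
by rewrite /y (_ : t = 1); [rewrite subrr scale0r scale1r add0r | nra].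
Qed.

Lemma chain_seg0 i : (i < m)%N -> segment (u i) (u i.+1) 0 -> i = 0%N.
Proof.
move=> im /(chain_seg im)[h _ _]; apply/eqP; rewrite -leqn0 leqNgt.
apply/negP => i0; have := chain_dot_lt i0 (ltnW im).
by move: h; rewrite (proj1 cu); lra.
Qed.

Lemma chain_seg_last i : (i < m)%N -> segment (u i) (u i.+1) (u m) -> i.+1 = m.
Proof.
move=> im /(chain_seg im)[_ h _]; apply/eqP; rewrite eqn_leq im leqNgt.
by apply/negP => i0; have := chain_dot_lt i0 (leqnn _); lra.
Qed.

(** Each side lies in its own annulus about the origin; consecutive annuli share only a circle,
    which the inner side meets only at its far end. *)
Lemma chain_noncrossing i j x : (i < j)%N -> (j < m)%N ->
  segment (u i) (u i.+1) x -> segment (u j) (u j.+1) x ->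
  j = i.+1 /\ x = u j.
Proof.
move=> ij jm xi xj; have im := ltn_trans ij jm.
have [_ h1 h2] := chain_seg im xi; have [h3 _ _] := chain_seg jm xj.
have h4 := chain_dot_le ij (ltnW jm).
have ji : j = i.+1.
  apply/eqP; rewrite eqn_leq ij andbT leqNgt; apply/negP => ij'.
  by have := chain_dot_lt ij' (ltnW jm); lra.
by split=> //; rewrite ji h2 //; lra.
Qed.

Lemma chain_dot_progress i : (i < m)%N ->
  0 < dot (u i.+1) (u i.+1 - u i).
Proof.
move=> im; have [h1 h2] := proj2 cu _ im.
have <- : l i ^+ 2 = dot (u i.+1) (u i.+1 - u i).
  by rewrite -h2 -[RHS]subr0 -h1 !dotE !mxE; ring.
by rewrite exprn_gt0 ?l_gt0.
Qed.

(** The side leaving [u i.+1] is perpendicular to that vector, while the side arriving there has a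
    positive component along it. *)
Lemma chain_vertex_cross i : (i.+1 < m)%N ->
  cross (u i - u i.+1) (u i.+2 - u i.+1) != 0.
Proof.
move=> im; case: cu => _ h.
have [h3 h4] := h _ im; have l1 : 0 < l i.+1 ^+ 2 by rewrite exprn_gt0 ?l_gt0.
set d := u i.+1 - u i; set e := u i.+2 - u i.+1 in h3 h4 *.
have wd : 0 < dot (u i.+1) d by apply: chain_dot_progress; rewrite ltnW.
have ww : 0 < dot (u i.+1) (u i.+1).
  exact: le_lt_trans (dot_ge0 _) (chain_dot_lt (ltnSn i) (ltnW im)).
have id1 : cross (u i - u i.+1) e * dot (u i.+1) (u i.+1) =
    - (dot (u i.+1) d * cross (u i.+1) e).
  rewrite -[RHS]addr0 -[X in _ = _ + X](mulr0 (cross (u i.+1) d)) -h3.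
  by rewrite /cross /d !dotE !mxE; ring.
apply/eqP => c0; move: id1; rewrite c0 mul0r => /eqP.
rewrite eq_sym oppr_eq0 mulf_eq0 gt_eqF //= => /eqP c1.
have := lagrange (u i.+1) e; rewrite h3 c1 h4; nra.
Qed.

End Chain.

(** * Existence of chains ending at a given point *)

Lemma chain_dot l m (u : nat -> 'rV[R]_2) i : chain l m u -> (i <= m)%N ->
  dot (u i) (u i) = \sum_(j < i) l j ^+ 2.
Proof.
move=> cu; elim: i => [|i IH] im.
  by rewrite big_ord0 (proj1 cu) dotE !mxE; ring.
by rewrite big_ord_recr /= (chain_dotS cu) // IH // ltnW.
Qed.

(* The two candidates for the previous vertex are mirror images in the line
   through the origin and [p]; one of them lies on the required side. *)
Lemma previous_vertex (P Q s : R) (p : 'rV[R]_2) :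
  s ^+ 2 = 1 -> 0 < Q -> Q < P -> dot p p = P -> 0 <= s * p 0 1 ->
  exists q : 'rV[R]_2, [/\ dot q q = Q, dot q p = Q & 0 < s * q 0 1].
Proof.
move=> s1 Q0 QP pP sp.
have P0 : P != 0 by rewrite gt_eqF //; lra.
(* [e] picks the mirror image whose part perpendicular to [p] contributes a nonnegative amount to
   [s * q 0 1]. *)
pose e : R := if 0 <= s * p 0 0 then 1 else -1.
have e2 : e ^+ 2 = 1 by rewrite /e; case: ifP => _; ring.
have ex : e * (s * p 0 0) = `|s * p 0 0|.
  rewrite /e; case: ifPn => [/ger0_norm ->|]; first by ring.
  by rewrite -ltNge => /ltr0_norm ->; ring.
pose T : R := Num.sqrt (Q * (P - Q)).
have QPQ : 0 < Q * (P - Q) by rewrite mulr_gt0 //; lra.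
have T0 : 0 < T by rewrite sqrtr_gt0.
have T2 : T ^+ 2 = Q * (P - Q) by rewrite sqr_sqrtr // ltW.
(* [P] times the vertex sought, whose component along [p] is [Q / P] times [p] and whose
   perpendicular part has squared length [Q * (P - Q) / P]. *)
pose q : 'rV[R]_2 := \row_k (if k == 0 then Q * p 0 0 - e * T * p 0 1
                            else Q * p 0 1 + e * T * p 0 0).
have qq : dot q q = Q * P ^+ 2.
  rewrite dotE !mxE /= -[in RHS]pP dotE.
  transitivity ((Q ^+ 2 + e ^+ 2 * T ^+ 2) * dot p p); first by rewrite dotE; ring.
  by rewrite e2 T2 -dotE pP; ring.
have qp : dot q p = Q * P by rewrite -pP !dotE !mxE /=; ring.
exists (P^-1 *: q); split.
- by rewrite dotZr dotC dotZr qq; field.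
- by rewrite dotC dotZr dotC qp; field.
- rewrite mxE mulrCA mulr_gt0 ?invr_gt0 //; first by lra.
  have -> : s * q 0 1 = Q * (s * p 0 1) + T * `|s * p 0 0|.
    by rewrite -ex mxE /=; ring.
  have := normr_ge0 (s * p 0 0) => n0.
  have [y0|y0] := eqVneq (s * p 0 1) 0; last first.
    by apply: ltr_pwDl; [rewrite mulr_gt0 // lt0r y0 | rewrite mulr_ge0 // ltW].
  rewrite y0 mulr0 add0r mulr_gt0 // normr_gt0; apply/eqP => x0.
  have : s ^+ 2 * dot p p = 0 by rewrite dotE; nra.
  by rewrite s1 pP; lra.
Qed.

(** Induction from the far end: [previous_vertex] supplies the penultimate vertex at the distance
    that the remaining sides require. The condition on [p] is weak so that the far vertex may lie on
    the axis. *)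
Lemma chain_exists l m (s : R) (p : 'rV[R]_2) :
  s ^+ 2 = 1 -> (forall i, (i <= m)%N -> 0 < l i) ->
  dot p p = \sum_(j < m.+1) l j ^+ 2 -> 0 <= s * p 0 1 ->
  exists u : nat -> 'rV[R]_2, [/\ chain l m.+1 u, u m.+1 = p &
    forall i, (0 < i)%N -> (i <= m)%N -> 0 < s * u i 0 1].
Proof.
move=> s1; elim: m p => [|m IH] p l0 pp sp.
  exists (fun i => if i is 0%N then 0 else p); split=> //; last first.
    by move=> i i0; rewrite leqNgt i0.
  split=> // -[|//] _; rewrite subr0; split; first by rewrite dotE !mxE; ring.
  by rewrite pp big_ord1.
set Q := \sum_(j < m.+1) l j ^+ 2.
have Q0 : 0 < Q.
  rewrite /Q big_ord_recr /= ltr_wpDl ?exprn_gt0 ?l0 //.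
  by apply: sumr_ge0 => j _; rewrite sqr_ge0.
have QP : Q < dot p p by rewrite pp big_ord_recr /= ltrDl exprn_gt0 // l0.
have [q [qq qp sq]] := previous_vertex s1 Q0 QP erefl sp.
have [|u [[u0 cu] um su]] := IH q _ qq (ltW sq).
  by move=> i im; apply/l0/leqW.
exists (fun i => if i == m.+2 then p else u i); split.
- split=> // i im; rewrite eqSS [i == m.+2]ltn_eqF //.
  have [->|im1] := eqVneq i m.+1; last by apply: cu; lia.
  rewrite um; split; first by rewrite dotBr qp qq subrr.
  transitivity (dot p p - Q).
    by rewrite dotBr ![dot (p - q) _]dotC !dotBr [dot p q]dotC qp qq; ring.
  by rewrite pp big_ord_recr /= addrC addrK.
- by rewrite eqxx.
- move=> i i0 im; rewrite ltn_eqF //; have [->|im1] := eqVneq i m.+1.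
    by rewrite um.
  by apply: su => //; lia.
Qed.

(** * Gluing two chains into a polygon *)

Definition meet_at_ends m m' (u u' : nat -> 'rV[R]_2) : Prop :=
  forall i j x, (i < m)%N -> (j < m')%N ->
  segment (u i) (u i.+1) x -> segment (u' j) (u' j.+1) x ->
  [/\ i = 0%N, j = 0%N & x = 0] \/ [/\ i.+1 = m, j.+1 = m' & x = u m].

(* The incoming arc of the polygon is the chain [u'] traversed backwards, so that
   both arcs are chains starting at the origin. *)
Section Assembly.
Variables (A m m' n : nat) (u u' : nat -> 'rV[R]_2).
Let l i : R := (A + i)%:R.
(** Read from the origin outwards, the incoming lengths decrease from that of the last side,
    [A + m + m' - 1]. *)
Let l' j : R := (A + m + m' - j.+1)%:R.
Hypotheses (A_gt0 : (0 < A)%N) (m_gt1 : (1 < m)%N) (m'_gt0 : (0 < m')%N).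
Hypothesis nE : n.+1 = (m + m')%N.
Hypotheses (cu : chain l m u) (cu' : chain l' m' u') (uu' : u m = u' m').

Let l_gt0 i : (i < m)%N -> 0 < l i.
Proof. by move=> _; rewrite ltr0n; lia. Qed.

Let l'_gt0 i : (i < m')%N -> 0 < l' i.
Proof. by move=> im; rewrite ltr0n; lia. Qed.

Definition join_chains (i : 'I_n.+1) : 'rV[R]_2 :=
  if (i <= m)%N then u i else u' (m + m' - i)%N.

Local Notation v := join_chains.

(** Case analysis on [sideP] rewrites both ends of a side at once; the sum in [SideIn] ties the two
    numberings without truncated subtraction. *)
Variant side_spec (i : 'I_n.+1) : 'rV[R]_2 -> 'rV[R]_2 -> Type :=
  | SideOut of (i < m)%N : side_spec i (u i) (u i.+1)
  | SideIn j of (j < m')%N & (i + j.+1 = m + m')%N : side_spec i (u' j.+1) (u' j).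

Lemma sideP i : side_spec i (v i) (v (ordS i)).
Proof.
have iN := ltn_ord i; rewrite /v.
have [im|mi] := ltnP i m.
  rewrite [(i <= m)%N]ltnW //= modn_small; last by lia.
  by rewrite im; exact: SideOut.
have jE : (i + (n - i).+1 = m + m')%N by lia.
have -> : (if (i <= m)%N then u i else u' (m + m' - i)%N) = u' (n - i).+1.
  case: ifPn => im; last by congr u'; lia.
  by rewrite (_ : i = m :> nat) ?uu'; [congr u' | ]; lia.
have -> : (if (ordS i <= m)%N then u (ordS i) else u' (m + m' - ordS i)%N) =
    u' (n - i)%N.
  (* The last side wraps around to index 0, where both chains are at the origin. *)
  have [iE|ni] := eqVneq (i : nat) n.
    by rewrite /= iE subnn modnn leq0n (proj1 cu) (proj1 cu').
  by rewrite /= modn_small ?ifN; [congr u' | |]; lia.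
by apply: SideIn => //; lia.
Qed.

Lemma ordS_nat (i j : 'I_n.+1) : j = i.+1 :> nat -> j = ordS i.
Proof.
by move=> ji; apply: val_inj; rewrite /= -ji modn_small // ltn_ord.
Qed.

Lemma ordS_last (i j : 'I_n.+1) : i = n :> nat -> j = 0%N :> nat -> j = ordS i.
Proof. by move=> iE jE; apply: val_inj; rewrite /= iE modnn. Qed.

Lemma join_side_length i : side_length v i = (A + i)%:R.
Proof.
rewrite /side_length /enorm /side_vec.
case: sideP => [im|j jm ij].
  by rewrite (proj2 (proj2 cu _ im)) sqrtr_sqr ger0_norm // ler0n.
have -> : dot (u' j - u' j.+1) (u' j - u' j.+1) = l' j ^+ 2.
  by rewrite -(proj2 (proj2 cu' _ jm)) !dotE !mxE; ring.
rewrite sqrtr_sqr ger0_norm ?ler0n // /l'; congr (_ %:R); lia.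
Qed.

Lemma join_perp i : exists p d, [/\ d != 0, dot d (side_vec v i) = 0,
  line p d (v ord0) & line p d (v i) \/ line p d (v (ordS i))].
Proof.
have s0 : side_vec v i != 0.
  apply/eqP => s0; have := join_side_length i.
  rewrite /side_length s0 /enorm dotE !mxE mul0r addr0 sqrtr0 => /eqP.
  by rewrite eq_sym pnatr_eq0; lia.
have -> : v ord0 = 0 by rewrite /v /= (proj1 cu).
move: s0; rewrite /side_vec.
case: sideP => [im|j jm ij] s0.
  have [p [d [d0 ds p0 pu]]] := perp_line s0 (proj1 (proj2 cu _ im)).
  by exists p, d; split=> //; left.
(* Incoming sides are traversed towards the origin, so the right angle is where the side
   finishes. *)
have h : dot (u' j) (u' j - u' j.+1) = 0.
  by rewrite -[RHS]oppr0 -(proj1 (proj2 cu' _ jm)) !dotBr opprB.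
have [p [d [d0 ds p0 pu]]] := perp_line s0 h.
by exists p, d; split=> //; right.
Qed.

Hypothesis sep : meet_at_ends m m' u u'.

Lemma join_not_self_intersecting : not_self_intersecting v.
Proof.
move=> i j x ij; have {}ij : (i != j :> nat) by [].
rewrite /side; case: (sideP i) => [im|k km ik]; case: (sideP j) => [jm|k' km' jk].
- move=> xi xj; have [lt_ij|] := ltnP i j.
    by have [/ordS_nat ji ->] := chain_noncrossing l_gt0 cu lt_ij jm xi xj; left.
  rewrite leq_eqVlt eq_sym (negPf ij) /= => lt_ji; right.
  by have [/ordS_nat ji ->] := chain_noncrossing l_gt0 cu lt_ji im xj xi.
- move=> xi; rewrite segmentC => xj.
  have [[i0 k0 ->]|[iE kE ->]] := sep im km' xi xj; [right|left]; split.
  + by apply: ordS_last => //; lia.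
  + by rewrite i0 (proj1 cu).
  + by apply: ordS_nat; lia.
  + by rewrite uu' kE.
- rewrite segmentC => xi xj.
  have [[j0 k0 ->]|[jE kE ->]] := sep jm km xj xi; [left|right]; split.
  + by apply: ordS_last => //; lia.
  + by rewrite j0 (proj1 cu).
  + by apply: ordS_nat; lia.
  + by rewrite uu' kE.
- rewrite segmentC => xi; rewrite segmentC => xj.
  have [lt_kk'|] := ltnP k k'.
    have [kE ->] := chain_noncrossing l'_gt0 cu' lt_kk' km' xi xj.
    by right; split; [apply: ordS_nat; lia | rewrite kE].
  rewrite leq_eqVlt => /orP[/eqP kE|lt_k'k]; first by lia.
  have [kE ->] := chain_noncrossing l'_gt0 cu' lt_k'k km xj xi.
  by left; split; [apply: ordS_nat; lia | rewrite kE].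
Qed.

Hypothesis cross_origin : cross (u 1%N) (u' 1%N) != 0.
Hypothesis cross_far : cross (u m.-1 - u m) (u' m'.-1 - u m) != 0.

(** Naming the vertex [ordS i] lets [sideP] describe both sides meeting there. The cases are an
    inner vertex of the outgoing arc, the far vertex, the origin, and an inner vertex of the
    incoming arc. *)
Lemma join_vertex_cross i :
  cross (v i - v (ordS i)) (v (ordS (ordS i)) - v (ordS i)) != 0.
Proof.
have cN (x y : 'rV[R]_2) : cross x y != 0 -> cross y x != 0.
  by rewrite -oppr_eq0 (_ : - _ = cross y x) // /cross; ring.
have iN := ltn_ord i.
have vS := sideP (ordS i); case: (sideP i) vS => [im|j jm ij].
  have iS : ordS i = i.+1 :> nat by rewrite /= modn_small //; lia.
  case=> [|j jm]; rewrite iS; [exact: chain_vertex_cross l_gt0 cu _ | move=> ij].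
  have -> : u' j.+1 = u m by rewrite uu'; congr u'; lia.
  by move: cross_far; rewrite (_ : m.-1 = i) 1?(_ : m'.-1 = j) //; lia.
case: j jm ij => [|j] jm ij.
  have iS : ordS i = 0%N :> nat by rewrite /= (_ : nat_of_ord i = n) ?modnn; lia.
  case=> [_|j' jm']; rewrite iS; last by lia.
  by rewrite (proj1 cu) !subr0; exact: cN.
have iS : ordS i = i.+1 :> nat by rewrite /= modn_small //; lia.
case=> [|j' jm']; rewrite iS => ij'; first by lia.
have -> : j = j' by lia.
by apply: cN; apply: chain_vertex_cross l'_gt0 cu' _ _; lia.
Qed.

Lemma join_arithmetic_polygon : arithmetic_polygon v.
Proof.
split.
- by lia.
- by move=> i; rewrite join_side_length ltr0n; lia.
- by move=> i; rewrite join_side_length natr_int.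
- move=> i imax; rewrite !join_side_length natr1 -addnS; congr (A + _)%:R.
  rewrite /= modn_small // ltnS ltn_neqAle -ltnS ltn_ord andbT.
  exact: imax.
- exact: join_perp.
- move=> i; rewrite -(ord_predK i) /vertex_angle ordSK.
  exact/angle_nondegenerate/join_vertex_cross.
Qed.

End Assembly.

(** * Separation by a line, and reflection of the first vertex *)

(** The line orthogonal to [g] weakly separates the segments, so a common point lies on it; a
    segment with one end off the line can touch it only at the other end. *)
Lemma half_plane_meet (g p q p' q' x : 'rV[R]_2) :
  0 <= dot g p -> 0 <= dot g q -> dot g p' <= 0 -> dot g q' <= 0 ->
  segment p q x -> segment p' q' x ->
  [/\ dot g x = 0, 0 < dot g q -> x = p & 0 < dot g p -> x = q].
Proof.
move=> gp gq gp' gq' [t [ht xE]] [t' [ht' xE']].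
have gx : dot g x = (1 - t) * dot g p + t * dot g q by rewrite xE dotDr !dotZr.
have gx' : dot g x = (1 - t') * dot g p' + t' * dot g q'.
  by rewrite xE' dotDr !dotZr.
have gx0 : dot g x = 0 by nra.
split=> // h; rewrite xE.
  rewrite (_ : t = 0); first by rewrite subr0 scale0r scale1r addr0.
  by nra.
rewrite (_ : t = 1); first by rewrite subrr scale0r scale1r add0r.
by nra.
Qed.

Lemma dot_cross u w x :
  dot u u * dot w x = dot u w * dot u x + cross u w * cross u x.
Proof. by rewrite !dotE /cross; ring. Qed.

Lemma cross_dot u w x :
  dot u u * cross w x = dot u w * cross u x - cross u w * dot u x.
Proof. by rewrite !dotE /cross; ring. Qed.

(* The reflection of the vertex [u 1] in the line through the origin and
   [u 2%N]. *)
Definition flip_first (u : nat -> 'rV[R]_2) i : 'rV[R]_2 :=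
  if i == 1%N then (2 * dot (u 1%N) (u 1%N) / dot (u 2%N) (u 2%N)) *: u 2%N - u 1%N
  else u i.

Section Flip.
Variables (l : nat -> R) (m : nat) (u : nat -> 'rV[R]_2).
Hypotheses (cu : chain l m u) (m_gt1 : (1 < m)%N).
Hypothesis l_gt0 : forall i, (i < m)%N -> 0 < l i.

Let w1 := flip_first u 1%N.

Lemma chain_sq1 : dot (u 1%N) (u 1%N) = l 0%N ^+ 2.
Proof. by rewrite (chain_dot cu) ?big_ord1 // ltnW. Qed.

Lemma chain_sq2 : dot (u 2%N) (u 2%N) = l 0%N ^+ 2 + l 1%N ^+ 2.
Proof. by rewrite (chain_dotS cu) // chain_sq1. Qed.

(** The right angle at [u 1%N] makes this equal to [dot (u 1%N) (u 1%N)], hence the numerator of the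
    reflection formula in [flip_first]. *)
Lemma chain_dot12 : dot (u 1%N) (u 2%N) = l 0%N ^+ 2.
Proof.
by have [h _] := proj2 cu _ m_gt1; move: h; rewrite dotBr chain_sq1; lra.
Qed.

Let D_gt0 : 0 < l 0%N ^+ 2 + l 1%N ^+ 2.
Proof. by rewrite addr_gt0 // exprn_gt0 // l_gt0 // ltnW. Qed.

Lemma flip_firstE : w1 = (2 * l 0%N ^+ 2 / (l 0%N ^+ 2 + l 1%N ^+ 2)) *: u 2%N - u 1%N.
Proof. by rewrite /w1 /flip_first eqxx chain_sq1 chain_sq2. Qed.

Lemma flip_first_dot2 : dot w1 (u 2%N) = l 0%N ^+ 2.
Proof.
rewrite flip_firstE dotC dotBr dotZr [dot (u 2%N) (u 1%N)]dotC chain_dot12 chain_sq2.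
by field; rewrite gt_eqF.
Qed.

Lemma flip_first_sq : dot w1 w1 = l 0%N ^+ 2.
Proof.
rewrite {2}flip_firstE dotBr dotZr flip_first_dot2 flip_firstE dotC dotBr dotZr chain_dot12 chain_sq1.
by field; rewrite gt_eqF.
Qed.

Lemma chain_flip : chain l m (flip_first u).
Proof.
split=> [|i im]; first exact: (proj1 cu).
case: i im => [|[|i]] im; last exact: (proj2 cu).
  rewrite -/w1 (_ : flip_first u 0%N = 0); last exact: (proj1 cu).
  rewrite !subr0 flip_first_sq; split=> //.
  by rewrite dotE !mxE; ring.
rewrite -/w1 (_ : flip_first u 2%N = u 2%N) //; split; first by rewrite dotBr flip_first_dot2 flip_first_sq subrr.
rewrite dotBr ![dot (u 2%N - w1) _]dotC (dotBr (u 2%N)) (dotBr w1) flip_first_dot2.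
by rewrite [dot (u 2%N) w1]dotC flip_first_dot2 chain_sq2 flip_first_sq; ring.
Qed.

(** By the collinearity, [cross w1 b] is a nonzero multiple of [cross (u 2%N) b]. Were that zero,
    [u 1%N] and [u 2%N] would be parallel, yet they span a nondegenerate right triangle. *)
Lemma flip_cross (b : 'rV[R]_2) : b != 0 -> cross (u 1%N) b = 0 -> cross w1 b != 0.
Proof.
move=> b0 ab; rewrite flip_firstE.
have l0 := l_gt0 (ltnW m_gt1); have l1 := l_gt0 m_gt1.
have -> k : cross (k *: u 2%N - u 1%N) b = k * cross (u 2%N) b - cross (u 1%N) b.
  by rewrite /cross !mxE; ring.
rewrite ab subr0 mulf_neq0 //.
  by rewrite mulf_neq0 ?invr_neq0 ?mulf_neq0 ?expf_neq0 ?pnatr_eq0 ?gt_eqF.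
apply/eqP => wb; have := cross_dot b (u 1%N) (u 2%N).
have -> : cross b (u 1%N) = 0 by rewrite -oppr0 -ab /cross; ring.
have -> : cross b (u 2%N) = 0 by rewrite -oppr0 -wb /cross; ring.
rewrite mul0r mulr0 subrr => /eqP; rewrite mulf_eq0 dot_eq0 (negPf b0) /= => /eqP c0.
have := lagrange (u 1%N) (u 2%N); rewrite c0 chain_dot12 chain_sq1 chain_sq2.
have : 0 < l 0%N ^+ 2 * l 1%N ^+ 2 by rewrite mulr_gt0 // exprn_gt0.
nra.
Qed.

End Flip.

(** * Construction of the two arcs *)

(** The x-axis separates the arcs. The last clause isolates the one possible defect: a single
    incoming side would end at [p] on the axis, not collinear with [u 1%N]. *)
Lemma half_plane_chains (m m' : nat) (l l' : nat -> R) :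
  (forall i, (i < m)%N -> 0 < l i) -> (forall i, (i < m')%N -> 0 < l' i) ->
  (1 < m)%N -> (0 < m')%N ->
  \sum_(i < m) l i ^+ 2 = \sum_(j < m') l' j ^+ 2 ->
  exists u u' : nat -> 'rV[R]_2,
  [/\ [/\ chain l m u, chain l' m' u' & u m = u' m'],
    cross (u m.-1 - u m) (u' m'.-1 - u m) != 0,
    meet_at_ends m m' u u', 0 < u 1%N 0 1 &
    cross (u 1%N) (u' 1%N) = 0 -> (1 < m')%N /\ u' 1%N 0 1 < 0].
Proof.
move=> l0 l'0 m1 m'0 lS.
pose p : 'rV[R]_2 := \row_k (if k == 0 then Num.sqrt (\sum_(i < m) l i ^+ 2) else 0).
have S0 : 0 <= \sum_(i < m) l i ^+ 2 by apply: sumr_ge0 => i _; rewrite sqr_ge0.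
have pp : dot p p = \sum_(i < m) l i ^+ 2.
  by rewrite dotE !mxE /= mulr0 addr0 -expr2 sqr_sqrtr.
have p1 : p 0 1 = 0 by rewrite mxE.
have [u [cu um uy]] : exists u : nat -> 'rV[R]_2, [/\ chain l m u, u m = p &
    forall i, (0 < i)%N -> (i < m)%N -> 0 < u i 0 1].
  have [||||u [cu um uy]] := @chain_exists l m.-1 1 p.
  - by rewrite expr1n.
  - by move=> i im; apply: l0; lia.
  - by rewrite pp prednK // ltnW.
  - by rewrite p1 mulr0.
  exists u; rewrite -{1 2}(prednK (ltnW m1)); split=> // i i0 im.
  by have := uy i i0; rewrite mul1r; apply; lia.
have [u' [cu' um' uy']] : exists u : nat -> 'rV[R]_2, [/\ chain l' m' u, u m' = p &
    forall i, (0 < i)%N -> (i < m')%N -> u i 0 1 < 0].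
  have [||||u' [cu' um' uy']] := @chain_exists l' m'.-1 (-1) p.
  - by rewrite sqrrN expr1n.
  - by move=> i im; apply: l'0; lia.
  - by rewrite pp lS prednK.
  - by rewrite p1 mulr0.
  exists u'; rewrite -{1 2}(prednK m'0); split=> // i i0 im.
  by have := uy' i i0; rewrite mulN1r oppr_gt0; apply; lia.
pose e1 : 'rV[R]_2 := delta_mx 0 1.
have ey x : dot e1 x = x 0 1 by rewrite dotE !mxE /=; ring.
have u00 : u 0%N 0 1 = 0 by rewrite (proj1 cu) mxE.
have u'00 : u' 0%N 0 1 = 0 by rewrite (proj1 cu') mxE.
have y_ge0 i : (i <= m)%N -> 0 <= dot e1 (u i).
  rewrite ey leq_eqVlt => /orP[/eqP ->|im]; first by rewrite um p1.
  by case: i im => [|i] im; [rewrite u00 | exact/ltW/uy].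
have y_le0 i : (i <= m')%N -> dot e1 (u' i) <= 0.
  rewrite ey leq_eqVlt => /orP[/eqP ->|im]; first by rewrite um' p1.
  by case: i im => [|i] im; [rewrite u'00 | exact/ltW/uy'].
have sep : meet_at_ends m m' u u'.
  move=> i j x im jm xi xj.
  have [gx xp xq] := half_plane_meet (y_ge0 _ (ltnW im)) (y_ge0 _ im)
    (y_le0 _ (ltnW jm)) (y_le0 _ jm) xi xj.
  have [i0|i0] := posnP i.
    have x0 : x = 0 by rewrite xp i0 ?(proj1 cu) // ey uy.
    by left; split=> //; apply: (chain_seg0 l'0 cu' jm); rewrite -x0.
  have xE : x = u i.+1 by apply: xq; rewrite ey uy.
  have iE : i.+1 = m.
    apply/eqP; rewrite eqn_leq im leqNgt; apply/negP => im1.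
    by have := uy i.+1 isT im1; rewrite -ey -xE gx; lra.
  right; split=> //; last by rewrite xE iE.
  by apply: (chain_seg_last l'0 cu' jm); rewrite um' -um -iE -xE.
have p0 : 0 < p 0 0.
  rewrite mxE /= sqrtr_gt0 -pp -um.
  have := chain_dot_lt l0 cu (ltnW m1) (leqnn _).
  by rewrite (proj1 cu) [X in X < _]dotE !mxE mul0r addr0.
clearbody p.
(* Both neighbours of [p] lie to its left, one strictly above the axis and the other on or below it,
   so the cross product is positive. *)
have far : cross (u m.-1 - u m) (u' m'.-1 - u m) != 0.
  have h1 : u m.-1 0 0 < p 0 0.
    have h : (m.-1 < m)%N by lia.
    have := chain_dot_progress l0 cu h; rewrite prednK ?(ltnW m1) // um.
    by rewrite dotE p1 mul0r addr0 pmulr_rgt0 // !mxE subr_gt0.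
  have h2 : u' m'.-1 0 0 < p 0 0.
    have h : (m'.-1 < m')%N by lia.
    have := chain_dot_progress l'0 cu' h; rewrite prednK // um'.
    by rewrite dotE p1 mul0r addr0 pmulr_rgt0 // !mxE subr_gt0.
  have h3 : 0 < u m.-1 0 1 by apply: uy; lia.
  have h4 : u' m'.-1 0 1 <= 0 by rewrite -ey y_le0 // leq_pred.
  by rewrite um /cross !mxE p1 subr0; apply/eqP; nra.
have a1 : 0 < u 1%N 0 1 by exact: uy.
exists u, u'; split=> //; first by split; rewrite // um.
move=> c0; have m'1 : (1 < m')%N.
  rewrite ltn_neqAle m'0 andbT; apply/eqP => m'E.
  have u'1 : u' 1%N = p by rewrite -um'; congr u'.
  by move: c0; rewrite u'1 /cross p1; nra.
by split=> //; exact: uy'.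
Qed.

(* The closed half-plane is bounded by a line through the origin that makes an
   angle of 3 pi / 4 with [p]: the reflection of [p] in the line through [q] is
   at angle less than 3 pi / 4 from [p], whereas [b] is opposite to [p] and [d]
   is at angle less than pi / 4 from [b]. *)
Lemma flip_half_plane (a c : R) (p q b d : 'rV[R]_2) :
  1 <= a -> a + 1 <= c ->
  dot p p = a ^+ 2 -> dot p q = a ^+ 2 -> dot q q = a ^+ 2 + (a + 1) ^+ 2 ->
  cross p b = 0 -> dot b b = (c + 1) ^+ 2 -> 0 < p 0 1 -> b 0 1 < 0 ->
  dot b (d - b) = 0 -> dot (d - b) (d - b) = c ^+ 2 ->
  exists g, [/\ 0 < dot g q,
    0 < dot g ((2 * a ^+ 2 / (a ^+ 2 + (a + 1) ^+ 2)) *: q - p),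
    dot g b < 0 & dot g d < 0].
Proof.
move=> a_ge1 ac pp pq qq c0 bb p1 b1 bd dd.
pose e := q - p; pose k := 2 * a ^+ 2 / (a ^+ 2 + (a + 1) ^+ 2).
(* The weights give the perpendicular vectors [p] and [e] the common length [a * (a + 1)], so [g]
   bisects their right angle. *)
exists ((a + 1) *: p + a *: e); set g := (_ *: p + _).
have gE x : dot g x = (a + 1) * dot p x + a * dot x e.
  by rewrite [LHS]dotC [LHS]dotDr !dotZr [dot x p]dotC.
have pe : dot p e = 0 by rewrite dotBr pq pp subrr.
have ee : dot e e = (a + 1) ^+ 2.
  rewrite dotBr [dot e q]dotC [dot e p]dotC pe dotBr qq [dot q p]dotC pq.
  by ring.
have bE : dot p b = - (a * (c + 1)).
  have hl := lagrange p b; rewrite c0 pp bb in hl.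
  have neg : dot p b < 0.
    rewrite -(pmulr_rlt0 _ p1).
    have -> : p 0 1 * dot p b = b 0 1 * dot p p - p 0 0 * cross p b.
      by rewrite !dotE /cross; ring.
    by rewrite c0 mulr0 subr0 pp nmulr_rlt0 // exprn_gt0; lra.
  have /eqP : (dot p b - a * (c + 1)) * (dot p b + a * (c + 1)) = 0.
    by move: hl; clear; set t := dot _ _ => hl; lra.
  have : 0 < a * (c + 1) by rewrite mulr_gt0; lra.
  by rewrite mulf_eq0 => ac0 /orP[] /eqP; clear -neg ac0; lra.
have be : dot b e = 0.
  have /eqP := dot_cross p b e; rewrite pe c0 pp mulr0 mul0r addr0 mulf_eq0.
  by rewrite sqrf_eq0 gt_eqF; [move/eqP | lra].
have pd : dot p (d - b) = 0.
  have /eqP := dot_cross b p (d - b); rewrite bd bb.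
  rewrite (_ : cross b p = 0); last by rewrite -oppr0 -c0 /cross; ring.
  rewrite mulr0 mul0r addr0 mulf_eq0 sqrf_eq0 gt_eqF; [by move/eqP | lra].
(* By Cauchy-Schwarz, passing from [b] to [d] raises [dot g] by at most [a * c * (a + 1)], less than
   the deficit [a * (a + 1) * (c + 1)] at [b]. *)
have de : dot (d - b) e <= c * (a + 1).
  have := lagrange (d - b) e; rewrite dd ee -exprMn.
  have := sqr_ge0 (cross (d - b) e); set t := dot _ _ => s0 hl.
  have h : 0 <= c * (a + 1) by rewrite mulr_ge0; lra.
  apply: le_trans (ler_norm _) _.
  rewrite -(@ler_pXn2r _ 2) ?nnegrE // -normrX ger0_norm ?sqr_ge0 //; lra.
have gb : dot g b = - (a * (a + 1) * (c + 1)) by rewrite gE be bE; ring.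
have aa1 : 0 < a * (a + 1) by rewrite mulr_gt0; lra.
split.
- rewrite gE pq dotBr qq [dot q p]dotC pq; clear -a_ge1; nra.
(* With the denominator of [k] cleared, the goal amounts to [2 * a ^+ 2 > 1]. *)
- have k0 : 0 < k * a ^+ 2.
    by rewrite /k mulr_gt0 ?divr_gt0 ?mulr_gt0 ?addr_gt0 ?exprn_gt0; lra.
  rewrite -/k gE [dot _ e]dotC !dotBr !dotZr pq pp [dot e q]dotC [dot e p]dotC.
  rewrite pe dotBr qq [dot q p]dotC pq.
  have : 0 <= a ^+ 2 * (a - 1) by rewrite mulr_ge0 ?sqr_ge0; lra.
  have : k * (a ^+ 2 + (a + 1) ^+ 2) = 2 * a ^+ 2.
    by rewrite /k; field; rewrite gt_eqF // addr_gt0 // exprn_gt0; lra.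
  by clear -k0; nra.
- by rewrite gb oppr_lt0 mulr_gt0; lra.
- have -> : dot g d = dot g b + dot g (d - b) by rewrite -dotDr addrC subrK.
  rewrite gb gE pd mulr0 add0r.
  have : a * dot (d - b) e <= a * (c * (a + 1)) by rewrite ler_pM2l; lra.
  by clear -aa1; lra.
Qed.

Lemma chains_exist (A m m' : nat) (l l' : nat -> R) :
  l = (fun i => (A + i)%:R) -> l' = (fun j => (A + m + m' - j.+1)%:R) ->
  (0 < A)%N -> (1 < m)%N -> (0 < m')%N ->
  \sum_(i < m) l i ^+ 2 = \sum_(j < m') l' j ^+ 2 ->
  exists u u' : nat -> 'rV[R]_2,
  [/\ [/\ chain l m u, chain l' m' u' & u m = u' m'],
    cross (u 1%N) (u' 1%N) != 0,
    cross (u m.-1 - u m) (u' m'.-1 - u m) != 0 &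
    meet_at_ends m m' u u'].
Proof.
move=> lE l'E A0 m1 m'0 lS.
have l0 i : (i < m)%N -> 0 < l i by rewrite lE ltr0n; lia.
have l'0 i : (i < m')%N -> 0 < l' i by rewrite l'E ltr0n; lia.
have [u [u' [[cu cu' uu'] far sep a1 b1]]] := half_plane_chains l0 l'0 m1 m'0 lS.
have [c0|c0] := eqVneq (cross (u 1%N) (u' 1%N)) 0; last by exists u, u'.
have {b1} [m'1 b1] := b1 c0.
have aa := chain_sq1 cu m1; have bb := chain_sq1 cu' m'1; have bb2 := chain_sq2 cu' m'1.
have ww := chain_sq2 cu m1; have aw := chain_dot12 cu m1.
pose a : R := l 0%N; pose c : R := l' 1%N.
have a_ge1 : 1 <= a by rewrite /a lE ler1n; lia.
have l1a : l 1%N = a + 1 by rewrite /a lE natr1; congr (_%:R); lia.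
have l'0c : l' 0%N = c + 1 by rewrite /c l'E natr1; congr (_%:R); lia.
have ac : a + 1 <= c.
  by rewrite /a /c lE l'E natr1 ler_nat; lia.
rewrite -/a l1a -/c l'0c in aa bb bb2 ww aw.
have far_out : dot (u 2%N) (u 2%N) < dot (u' 2%N) (u' 2%N) by rewrite ww bb2; nra.
(* If [m = 2], then [u 2%N] is the far vertex, hence no nearer to the origin than [u' 2%N]. So the
   flip leaves the sides at the far vertex untouched. *)
have m2 : (2 < m)%N.
  rewrite ltn_neqAle m1 andbT; apply/eqP => m2; move: far_out.
  by rewrite {1 2}m2 uu'; have := chain_dot_le l'0 cu' m'1 (leqnn _); lra.
pose z := flip_first u.
have cz : chain l m z := chain_flip cu m1 l0.
have zE i : i != 1%N -> z i = u i by rewrite /z /flip_first => /negPf ->.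
have b0 : u' 1%N != 0 by rewrite -dot_eq0 bb expf_neq0 // gt_eqF //; lra.
have [bd dd] := proj2 cu' _ m'1; rewrite -/c in dd.
have [g [gw gz1 gb gb2]] := flip_half_plane a_ge1 ac aa aw ww c0 bb a1 b1 bd dd.
rewrite -[a]/(l 0%N) -l1a -(flip_firstE cu m1) -/z in gz1.
have z1b : cross (z 1%N) (u' 1%N) != 0 := flip_cross cu m1 l0 b0 c0.
have zm : z m = u m by rewrite zE // gtn_eqF.
clearbody z; exists z, u'; split=> //.
- by split=> //; rewrite zm.
- rewrite zm.
  by have -> : z m.-1 = u m.-1 by apply: zE; clear -m2; lia.
have gz0 : dot g (z 0%N) = 0 by rewrite (proj1 cz) dotE !mxE; ring.
move=> i j x im jm.
have [i2|] := ltnP 1 i.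
  have -> : z i = u i by rewrite zE // gtn_eqF.
  have -> : z i.+1 = u i.+1 by rewrite zE // gtn_eqF // ltnW.
  by rewrite zm; exact: sep.
move=> i1 xi xj.
(* The first two sides stay within distance [u 2%N] of the origin, which leaves only the two sides
   of [u'] nearest the origin. *)
have xw : dot x x <= dot (u 2%N) (u 2%N).
  have [_ h _] := chain_seg l0 cz im xi; apply: le_trans h _.
  by have := chain_dot_le l0 cz (i1 : (i.+1 <= 2)%N) m1; rewrite (zE 2%N).
have j1 : (j <= 1)%N.
  rewrite leqNgt; apply/negP => j2.
  have [h _ _] := chain_seg l'0 cu' jm xj.
  by have := chain_dot_le l'0 cu' j2 (ltnW jm); lra.
have gz k : (k <= 2)%N -> 0 <= dot g (z k).
  by case: k => [|[|[|//]]] _; rewrite ?gz0 ?(ltW gz1) // zE // ltW.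
have gu' k : (k <= 2)%N -> dot g (u' k) <= 0.
  case: k => [|[|[|//]]] _; first by rewrite (proj1 cu') -(proj1 cz) gz0.
    exact: ltW.
  exact: ltW.
have [gx xp xq] := half_plane_meet (gz i (leqW i1)) (gz i.+1 i1)
  (gu' j (leqW j1)) (gu' j.+1 j1) xi xj.
have [i0|i0] := posnP i.
  have x0 : x = 0 by rewrite xp i0 // (proj1 cz).
  by left; split=> //; apply: (chain_seg0 l'0 cu' jm); rewrite -x0.
(* On the second side only [z 1%N] could be common, but it is strictly off the separating line. *)
have iE : i = 1%N by apply/eqP; rewrite eqn_leq i1 i0.
have x1 : x = z 1%N by rewrite xp iE // zE.
by move: gz1; rewrite -x1 gx ltxx.
Qed.

End Plane.

(** * Integer ranges and the final polygon *)

Lemma int_range_nat (A k : nat) :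
  int_range A%:Z (A%:Z + k%:Z - 1) = [seq (A + i)%N%:Z | i <- iota 0 k].
Proof.
rewrite /int_range (_ : _ - _ + 1 = k%:Z); last by ring.
by apply: eq_map => i; rewrite PoszD.
Qed.

Lemma sum_sq_int_range (R : realType) (A k : nat) :
  (\sum_(i <- int_range A%:Z (A%:Z + k%:Z - 1)) i ^+ 2)%:~R =
  \sum_(i < k) (A + i)%:R ^+ 2 :> R.
Proof.
rewrite int_range_nat big_map -{1}[k]subn0 -[iota _ _]/(index_iota 0 k) big_mkord.
by rewrite rmorph_sum; apply: eq_bigr => i _; rewrite rmorphXn.
Qed.

Theorem theorem3p2 (R : realType) (a b c : int)
  (ha : 0 < a + 1) (hab : a + 1 < b) (hbc : b < c)
  (hsum : \sum_(k <- int_range (a + 1) b) k ^+ 2 =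
          \sum_(k <- int_range (b + 1) c) k ^+ 2) :
  exists (n : nat) (v : 'I_n.+1 -> 'rV[R]_2),
    [/\ arithmetic_polygon v,
        side_lengths v = [seq k%:~R | k <- int_range (a + 1) c] &
        not_self_intersecting v].
Proof.
have [A [m [m' [[A0 m1 m'0] [aE bE cE]]]]] : exists A m m' : nat,
    [/\ (0 < A)%N, (1 < m)%N & (0 < m')%N] /\
    [/\ a + 1 = A%:Z, b = A%:Z + m%:Z - 1 & c = A%:Z + (m + m')%N%:Z - 1].
  (* The first length, and the numbers of sides up to [b] and after it. *)
  exists (absz (a + 1)), (absz (b - a)), (absz (c - b)).
  by split; split; lia.
have cE' : c = (A + m)%N%:Z + m'%:Z - 1 by rewrite cE; lia.
have bE' : b + 1 = (A + m)%N%:Z by rewrite bE; lia.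
pose l i : R := (A + i)%:R.
pose l' j : R := (A + m + m' - j.+1)%:R.
have lS : \sum_(i < m) l i ^+ 2 = \sum_(j < m') l' j ^+ 2.
  (* [l'] counts down from [c], so the index is reversed to match the range. *)
  rewrite [RHS](reindex_inj rev_ord_inj) -sum_sq_int_range.
  rewrite -bE -aE hsum bE' cE' sum_sq_int_range.
  by apply: eq_bigr => i _; have im := ltn_ord i; rewrite /l' /=; congr (_%:R ^+ 2); lia.
have [u [u' [[cu cu' uu'] cross_O cross_far sep]]] :=
  chains_exist (erefl l) (erefl l') A0 m1 m'0 lS.
have nE : (m + m').-1.+1 = (m + m')%N by lia.
exists (m + m').-1, (join_chains m m' u u'); split.
- exact: join_arithmetic_polygon A0 m1 m'0 nE cu cu' uu' cross_O cross_far.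
- rewrite aE cE int_range_nat -map_comp -[in iota 0 _]nE -val_enum_ord -map_comp.
  apply: eq_map => i /=.
  exact: join_side_length A0 m1 m'0 nE cu cu' uu' i.
- exact: join_not_self_intersecting A0 m1 m'0 nE cu cu' uu' sep.
Qed.
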